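(* Algorithm Sample_exactly (defined in the context) samples an edge from the uniform distribution on $E$, in expected time $O\!\left(\frac{n\log n}{\sqrt m}\right)$.
   Context: Setting. $G$ is a finite simple graph with vertex set $V$, $|V|=n$, having at least one edge. Each undirected edge is replaced by two directed edges going in opposite directions; $E$ is the resulting set of directed edges and $m=|E|$, which is assumed known. $d(v)$ is the degree of $v$. The graph is accessed in the standard sublinear graph model: uniform random vertex queries, degree queries (given $v$, return $d(v)$), and neighborhood queries (given $v$ and $j$, return the $j$th neighbor of $v$, or nothing if $v$ has fewer than $j$ neighbors). There is no random edge query. Let $\theta=\lceil\sqrt{2m}\rceil$. A vertex $v$ is light if $d(v)\le\theta$ and heavy otherwise. $N_H(v)$ is the set of heavy neighbors of $v$, and $d_H(v)=|N_H(v)|$. Sampling_attempt($k$). (1) Sample $u_0\in V$ uniformly at random and query its degree; if $d(u_0)>\theta$, fail. (2) Choose $j\in\{1,\dots,\theta\}$ uniformly at random and let $u_1$ be the $j$th neighbor of $u_0$; if there is none, fail. (3) For $i=2,\dots,k$: if $u_{i-1}$ is light, fail; otherwise let $u_i$ be a uniformly random neighbor of $u_{i-1}$. (4) Return $(u_{k-1},u_k)$. Sample_edge($\epsilon$). Let $\ell=\lceil\log_2\frac1\epsilon\rceil+1$. Repeat: pick $k\in\{1,\dots,\ell\}$ uniformly at random and call Sampling_attempt($k$). Stop at the first call that does not fail and return its result. Sample_exactly. Let $\epsilon=1/n^3$ and $\ell=\lceil\log_2\frac1\epsilon\rceil+1$. - With probability $1-\epsilon$: run Sample_edge($\epsilon$)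 and return its output. - Otherwise (with probability $\epsilon$): compute numbers $h_{v,i}$ for all $v\in V$ and $1\le i\le\ell$, in $\ell$ successive phases, as follows. For light $v$, $h_{v,i}=0$ for all $i$. For heavy $v$, $h_{v,1}=\frac{d_H(v)}{d(v)}$ and, for $i\ge2$, $h_{v,i}=h_{v,1}\sum_{w\in N_H(v)}h_{w,i-1}/d_H(v)$ (read as $0$ if $d_H(v)=0$). Then return a random edge, picking $(v,w)\in E$ with probability $$\frac{\frac1m-(1-\epsilon)\,\frac{1-h_{v,\ell}}{\sum_{(u,u')\in E}(1-h_{u,\ell})}}{\epsilon}.$$
   Formalization: In the fallback probability of Sample_exactly, h_{v,ℓ} and h_{u,ℓ} are replaced by h_{v,ℓ-1} and h_{u,ℓ-1}; with index ℓ the output is not uniform, e.g. for two adjacent centers with 9 leaves each. *)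

(* Defs.v *)
From mathcomp Require Import all_boot all_order all_algebra.
From mathcomp Require Import reals ereal sequences exp.

Set Implicit Arguments.
Unset Strict Implicit.
Unset Printing Implicit Defensive.

Import Order.TTheory GRing.Theory Num.Theory.
Local Open Scope ring_scope.

(* A finite simple graph together with the (arbitrary) order in which its
   neighbor lists are presented to an algorithm. *)
Record graph (V : finType) := Graph {
  adj : rel V;
  nbrs : V -> seq V;
  adj_sym : symmetric adj;
  adj_irr : irreflexive adj;
  nbrs_uniq : forall v, uniq (nbrs v);
  mem_nbrs : forall v w, (w \in nbrs v) = adj v w
}.

(* Both orientations of every undirected edge, so #|edges G| is twice the
   number of undirected edges. *)
Definition edges (V : finType) (G : graph V) : {set V * V} :=
  [set e | adj G e.1 e.2].

Definition degree (V : finType) (G : graph V) (v : V) : nat :=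
  #|[set w | adj G v w]|.

(* The elementary instructions, indexed by the type of their answer. The first
   three are the queries of the model and are the only access to the graph.
   [Unif k] is a uniform element of {1, ..., k}, [Draw s] a draw from the
   finite distribution with table s, and [Compute x] one step of computation
   (unit-cost arithmetic on reals) with result x. *)
Inductive op (R V : Type) : Type -> Type :=
  | SampleVertex : op R V V
  | Degree of V : op R V nat
  | Neighbor of V & nat : op R V (option V)
  | Unif of nat : op R V nat
  | Draw X of seq (X * R) : op R V X
  | Compute X of X : op R V X.

Arguments SampleVertex {R V}.
Arguments Degree {R V} _.
Arguments Neighbor {R V} _ _.
Arguments Unif {R V} _.
Arguments Draw {R V X} _.
Arguments Compute {R V X} _.

(* Randomized algorithms as possibly infinite trees. A tree is built without
   reference to a graph, which only enters through the answers to queries. *)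
CoInductive prog (R V A : Type) : Type :=
  | Ret of A
  | Op X of op R V X & (X -> prog R V A).

Arguments Ret {R V A} _.
Arguments Op {R V A X} _ _.

CoFixpoint bind (R V A B : Type) (p : prog R V A) (f : A -> prog R V B) :
    prog R V B :=
  match p with
  | Ret a => f a
  | Op X o k => Op o (fun x => bind (k x) f)
  end.

Notation "'let*' x := p 'in' q" := (bind p (fun x => q))
  (at level 200, x name, p at level 100, q at level 200).

Definition ask (R V X : Type) (o : op R V X) : prog R V X := Op o Ret.

Definition compute (R V X : Type) (x : X) : prog R V X := ask (Compute x).

Arguments ask {R V X} _.
Arguments compute {R V X} _.

(* Run p to its end; if it fails (returns None), spend one step and start body
   afresh. *)
CoFixpoint retry_from (R V A : Type) (body p : prog R V (option A)) :
    prog R V A :=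
  match p with
  | Ret (Some a) => Ret a
  | Ret None => Op (Compute tt) (fun=> retry_from body body)
  | Op X o k => Op o (fun x => retry_from body (k x))
  end.

Definition retry (R V A : Type) (body : prog R V (option A)) : prog R V A :=
  retry_from body body.

Fixpoint mapM (R V A B : Type) (f : A -> prog R V B) (s : seq A) :
    prog R V (seq B) :=
  match s with
  | [::] => Ret [::]
  | a :: s' => let* b := f a in let* bs := mapM f s' in Ret (b :: bs)
  end.

(* The table of f over all vertices; x0 is an unused default value. *)
Definition tabulate (R : Type) (V : finType) (T : Type) (x0 : T)
    (f : V -> prog R V T) : prog R V (V -> T) :=
  let* s := mapM f (enum V) in
  Ret (fun v => nth x0 s (enum_rank v)).

Fixpoint sumM (R : realType) (V A : Type) (F : A -> R) (s : seq A) :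
    prog R V R :=
  match s with
  | [::] => Ret 0
  | a :: s' => let* r := sumM V F s' in compute (F a + r)
  end.

Arguments sumM {R V A} F s.

Section Semantics.
Context (R : realType) (V : finType) (G : graph V).

Definition is_distr (X : Type) (s : seq (X * R)) : bool :=
  all (fun xq => 0 <= xq.2) s && (\sum_(xq <- s) xq.2 == 1).

(* The possible answers to an instruction, with their probabilities. Drawing
   from a table which is not a probability distribution has no answer: the
   execution is lost and never terminates. *)
Definition answers (X : Type) (o : op R V X) : seq (X * R) :=
  match o in op _ _ X return seq (X * R) with
  | SampleVertex => [seq (v, #|V|%:R^-1) | v <- enum V]
  | Degree v => [:: (degree G v, 1)]
  | Neighbor v j =>
      [:: (if j is j'.+1 then onth (nbrs G v) j' else None, 1)]
  | Unif k => [seq (i, k%:R^-1) | i <- iota 1 k]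
  | Draw X s => if is_distr s then s else [::]
  | Compute X x => [:: (x, 1)]
  end.

(* The probability that p terminates after exactly t instructions and then
   returns a: every instruction takes one unit of time. *)
Fixpoint law (A : eqType) (p : prog R V A) (t : nat) (a : A) : R :=
  match p, t with
  | Ret b, 0%N => (b == a)%:R
  | Ret _, _.+1 => 0
  | Op _ _ _, 0%N => 0
  | Op X o k, t'.+1 => \sum_(xq <- answers o) xq.2 * law (k xq.1) t' a
  end.

Definition output_prob (A : eqType) (p : prog R V A) (a : A) : \bar R :=
  (\sum_(0 <= t <oo) (law p t a)%:E)%E.

Definition terminates_as (A : finType) (p : prog R V A) : Prop :=
  (\sum_(0 <= t <oo) (\sum_(a : A) law p t a)%:E = 1)%E.

(* The mean of the running time; only meaningful for a program which
   terminates almost surely. *)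
Definition expected_time (A : finType) (p : prog R V A) : \bar R :=
  (\sum_(0 <= t <oo) (t%:R * \sum_(a : A) law p t a)%:E)%E.

End Semantics.

Section Algorithms.
Context (R : realType) (V : finType).

(* Steps i = 2, ..., k of a sampling attempt, when [steps] of them remain and
   the last two vertices are u' and u. *)
Fixpoint walk (theta steps : nat) (u' u : V) : prog R V (option (V * V)) :=
  match steps with
  | 0%N => Ret (Some (u', u))
  | steps'.+1 =>
      let* d := ask (Degree u) in
      if (d <= theta)%N then Ret None else
      let* j := ask (Unif d) in
      let* r := ask (Neighbor u j) in
      if r is Some w then walk theta steps' u w else Ret None
  end.

Definition sampling_attempt (theta k : nat) : prog R V (option (V * V)) :=
  let* u0 := ask SampleVertex in
  let* d0 := ask (Degree u0) in
  if (theta < d0)%N then Ret None else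
  let* j := ask (Unif theta) in
  let* r := ask (Neighbor u0 j) in
  if r is Some u1 then walk theta k.-1 u0 u1 else Ret None.

Definition threshold (m : nat) : nat :=
  `|Num.ceil (Num.sqrt (2 * m%:R) : R)|%N.

Definition levels (eps : R) : nat := `|Num.ceil (ln eps^-1 / ln 2)|%N.+1.

Definition sample_edge (m : nat) (eps : R) : prog R V (V * V) :=
  let* theta := compute (threshold m) in
  let* l := compute (levels eps) in
  retry (let* k := ask (Unif l) in sampling_attempt theta k).

(* Phases 1, ..., i of the computation of h, from the neighbor lists N and the
   lists NH of heavy neighbors; the result h is such that h j v is h_{v,j}.
   When NH v is empty both divisions below give 0. *)
Fixpoint h_phases (theta : nat) (N NH : V -> seq V) (i : nat) :
    prog R V (nat -> V -> R) :=
  match i with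
  | 0%N => Ret (fun _ _ => 0)
  | i'.+1 =>
      let* h := h_phases theta N NH i' in
      let* row := tabulate 0 (fun v =>
        if (size (N v) <= theta)%N then compute 0 else
        if i' == 0%N then compute ((size (NH v))%:R / (size (N v))%:R) else
        let* s := sumM (h i') (NH v) in
        compute (h 1%N v * (s / (size (NH v))%:R))) in
      Ret (fun j => if j == i then row else h j)
  end.

(* Sampling from an explicit table also costs one step per entry, spent when
   the table is built. *)
Definition exact_fallback (m : nat) (eps : R) : prog R V (V * V) :=
  let* theta := compute (threshold m) in
  let* l := compute (levels eps) in
  let* N := tabulate [::] (fun v =>
    let* d := ask (Degree v) in
    let* r := mapM (fun j => ask (Neighbor v j)) (iota 1 d) in
    Ret (pmap id r)) in
  let* NH := tabulate [::] (fun v =>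
    let* b := mapM (fun w => compute (theta < size (N w))%N) (N v) in
    Ret (mask b (N v))) in
  let* h := h_phases theta N NH l in
  let* E := mapM (fun v => mapM (fun w => compute (v, w)) (N v)) (enum V) in
  (* The index is l - 1, not l: the first heavy vertex of an attempt is u_1, so
     with k <= l the attempts reach heavy vertices in l - 1 rounds, and return
     each edge leaving v with total probability proportional to
     1 - h_{v,l-1}. With index l the overall output would not be uniform. *)
  let c := fun e : V * V => 1 - h l.-1 e.1 in
  let* S := sumM c (flatten E) in
  let* T := mapM (fun e =>
    compute (e, (m%:R^-1 - (1 - eps) * (c e / S)) / eps)) (flatten E) in
  ask (Draw T).

Definition sample_exactly (m : nat) : prog R V (V * V) :=
  let* eps := compute ((#|V| ^ 3)%:R^-1) in
  let* b := ask (Draw [:: (true, 1 - eps); (false, eps)]) in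
  if b then sample_edge m eps else exact_fallback m eps.

End Algorithms.

(* Main.v *)
Require Import Defs.
From mathcomp Require Import all_boot all_order all_algebra.
From mathcomp Require Import boolp classical_sets reals ereal topology.
From mathcomp Require Import normedtype sequences exp.
From mathcomp Require Import ring lra zify.

(* A sampling attempt returns the edge (v, w) with a probability which depends on
   v only. Let B f v be the mean of f over the neighbors of v if v is heavy, and
   0 if v is light. The walk of an attempt evolves by the adjoint of B, and the
   light vertices, where it starts, have indicator 1 - B 1; so the attempt with
   k steps returns (v, w) with probability (B^(k-1) 1 - B^k 1)(v) / (n theta),
   and the sum over k <= l telescopes to (1 - B^l 1)(v) / (n theta), where
   B^l 1 = h_{.,l-1}. Less than half of the neighbors of a heavy vertex are
   heavy, so B^l 1 <= 2^(1-l) <= eps: this makes the correction table of the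
   fallback a probability distribution, and the average of both branches is
   uniform by construction. For the time, the walk survives a step with
   probability at most 1/2, so an attempt takes O(1) steps on average, and
   O(l n / sqrt m) attempts are made; the fallback takes O(l n^2) steps but is
   entered with probability n^-3 only. *)

Set Implicit Arguments.
Unset Strict Implicit.
Unset Printing Implicit Defensive.

Import Order.TTheory GRing.Theory Num.Theory.
Import numFieldNormedType.Exports.
Local Open Scope classical_set_scope.
Local Open Scope ring_scope.

(** * Expectations over program executions *)

Section ProgEquations.
Context (R V : Type).

Definition prog_unfold (A : Type) (p : prog R V A) : prog R V A :=
  match p with Ret a => Ret a | Op X o k => Op o k end.

Lemma prog_unfoldE (A : Type) (p : prog R V A) : p = prog_unfold p.
Proof. by case: p. Qed.

Lemma bind_ret (A B : Type) (a : A) (f : A -> prog R V B) : bind (Ret a) f = f a.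
Proof. by rewrite [LHS]prog_unfoldE [RHS]prog_unfoldE. Qed.

Lemma bind_op (A B X : Type) (o : op R V X) (k : X -> prog R V A)
    (f : A -> prog R V B) : bind (Op o k) f = Op o (fun x => bind (k x) f).
Proof. by rewrite [LHS]prog_unfoldE. Qed.

Lemma retry_from_some (A : Type) (body : prog R V (option A)) (a : A) :
  retry_from body (Ret (Some a)) = Ret a.
Proof. by rewrite [LHS]prog_unfoldE. Qed.

Lemma retry_from_none (A : Type) (body : prog R V (option A)) :
  retry_from body (Ret None) = Op (Compute tt) (fun=> retry body).
Proof. by rewrite [LHS]prog_unfoldE. Qed.

Lemma retry_from_op (A X : Type) (body : prog R V (option A)) (o : op R V X)
    (k : X -> prog R V (option A)) :
  retry_from body (Op o k) = Op o (fun x => retry_from body (k x)).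
Proof. by rewrite [LHS]prog_unfoldE. Qed.

End ProgEquations.

Section Expectation.
Context (R : realType) (V : finType) (G : graph V).
Implicit Types A B X : Type.

Lemma answers_ge0 X (o : op R V X) : List.Forall (fun xq => 0 <= xq.2) (answers G o).
Proof.
case: o => [|v|v j|k|Y s|Y x] /=; try by repeat constructor; rewrite ?ler01.
- by elim: (enum V) => //= v s IH; constructor; rewrite //= invr_ge0.
- by elim: (iota 1 k) => //= v s IH; constructor; rewrite //= invr_ge0.
case: ifP => // /andP[+ _]; elim: s => //= x s IH /andP[x0 s0].
by constructor=> //; exact: IH.
Qed.

(** Only an inequality: [Unif 0], [SampleVertex] on an empty [V] and [Draw] from an invalid table
    have no answers at all. *)
Lemma answers_sum X (o : op R V X) : \sum_(xq <- answers G o) xq.2 <= 1.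
Proof.
case: o => [|v|v j|k|Y s|Y x] /=; try by rewrite big_seq1.
- rewrite big_map big_const_seq count_predT -cardE iter_addr_0 -[_ *+ _]mulr_natr.
  by case: (#|V|) => [|n]; rewrite ?mulr0 ?ler01// mulVf// pnatr_eq0.
- rewrite big_map big_const_seq count_predT size_iota iter_addr_0 -[_ *+ _]mulr_natr.
  by case: k => [|n]; rewrite ?mulr0 ?ler01// mulVf// pnatr_eq0.
- by case: ifP => [/andP[_ /eqP ->]//|_]; rewrite big_nil ler01.
Qed.

Lemma ler_sum_answers X (o : op R V X) (F1 F2 : X * R -> R) :
  (forall xq, F1 xq <= F2 xq) ->
  \sum_(xq <- answers G o) xq.2 * F1 xq <= \sum_(xq <- answers G o) xq.2 * F2 xq.
Proof.
move=> le12; elim: (answers_ge0 o) => [|x s x0 _ IH]; first by rewrite !big_nil.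
by rewrite !big_cons lerD// ler_wpM2l.
Qed.

Lemma sum_answers_le X (o : op R V X) (F : X * R -> R) (M : R) : 0 <= M ->
  (forall xq, F xq <= M) -> \sum_(xq <- answers G o) xq.2 * F xq <= M.
Proof.
move=> M0 FM; apply: (le_trans (ler_sum_answers o FM)).
by rewrite -mulr_suml ler_piMl// answers_sum.
Qed.

Lemma sum_answers_ge0 X (o : op R V X) (F : X * R -> R) :
  (forall xq, 0 <= F xq) -> 0 <= \sum_(xq <- answers G o) xq.2 * F xq.
Proof.
move=> F0; have := ler_sum_answers o F0.
by rewrite big1 // => i _; rewrite mulr0.
Qed.

(* The expectation of phi of the result plus c times the number of steps, where
   an execution which is not over after N steps is cut off: it still pays for
   its N steps, but phi counts as 0. *)
Fixpoint wp (c : R) (A : Type) (N : nat) (p : prog R V A) (phi : A -> R) : R :=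
  match p with
  | Ret a => phi a
  | Op X o k =>
      if N is N'.+1 then
        c + \sum_(xq <- answers G o) xq.2 * wp c N' (k xq.1) phi
      else 0
  end.

Lemma wp_ret c A N (a : A) phi : wp c N (Ret a) phi = phi a.
Proof. by case: N. Qed.

Lemma ler_wp c A N (p : prog R V A) (phi psi : A -> R) :
  (forall a, phi a <= psi a) -> wp c N p phi <= wp c N p psi.
Proof.
move=> le_pp; elim: N p => [|N IH] [a|X o k] //=.
by rewrite lerD2l ler_sum_answers.
Qed.

Lemma wp_ge0 c A N (p : prog R V A) (phi : A -> R) : 0 <= c ->
  (forall a, 0 <= phi a) -> 0 <= wp c N p phi.
Proof.
move=> c0 phi0; elim: N p => [|N IH] [a|X o k] //=.
by rewrite addr_ge0// sum_answers_ge0.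
Qed.

Lemma wp_leS c A N (p : prog R V A) (phi : A -> R) : 0 <= c ->
  (forall a, 0 <= phi a) -> wp c N p phi <= wp c N.+1 p phi.
Proof.
move=> c0 phi0; elim: N p => [|N IH] [a|X o k] //.
  exact: wp_ge0.
by rewrite /= lerD2l ler_sum_answers.
Qed.

Lemma wp_le_cst A N (p : prog R V A) (phi : A -> R) (M : R) : 0 <= M ->
  (forall a, phi a <= M) -> wp 0 N p phi <= M.
Proof.
move=> M0 phiM; elim: N p => [|N IH] [a|X o k] //=.
by rewrite add0r sum_answers_le.
Qed.

Lemma wpD A N (p : prog R V A) (phi psi : A -> R) c d :
  wp (c + d) N p (fun a => phi a + psi a) = wp c N p phi + wp d N p psi.
Proof.
elim: N p => [|N IH] [a|X o k] //=; first by rewrite addr0.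
rewrite addrACA; congr (_ + _).
by rewrite -big_split; apply: eq_bigr => xq _; rewrite IH mulrDr.
Qed.

Lemma wpZ A N (p : prog R V A) (phi : A -> R) c a :
  wp (a * c) N p (fun x => a * phi x) = a * wp c N p phi.
Proof.
elim: N p => [|N IH] [x|X o k] //=; first by rewrite mulr0.
rewrite mulrDr; congr (_ + _).
by rewrite mulr_sumr; apply: eq_bigr => xq _; rewrite IH mulrCA.
Qed.

(** The continuation runs with one step less than [N]; monotonicity in the cutoff allows the same
    [N] on both sides, so that costs add up without bookkeeping. *)
Lemma wp_ask_le c A X N (o : op R V X) (f : X -> prog R V A) phi :
  0 <= c -> (forall b, 0 <= phi b) ->
  wp c N (bind (ask o) f) phi <=
  c + \sum_(xq <- answers G o) xq.2 * wp c N (f xq.1) phi.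
Proof.
move=> c0 phi0; rewrite /ask bind_op; case: N => [|N] /=.
  by rewrite addr_ge0// sum_answers_ge0// => x; exact: (@wp_ge0 c _ 0).
by rewrite lerD2l ler_sum_answers// => x; rewrite bind_ret wp_leS.
Qed.

(** A restart happens with part of the budget [N] already spent; granting it the full [N] again only
    increases the right-hand side and yields a recursive inequality for [retry body]. *)
Lemma wp_retry_from_le c A N (body p : prog R V (option A)) phi :
  0 <= c -> (forall b, 0 <= phi b) ->
  wp c N (retry_from body p) phi <=
  wp c N p (fun r => if r is Some a then phi a else c + wp c N (retry body) phi).
Proof.
move=> c0 phi0; elim: N p => [|N IH] [[a|]|X o k];
  rewrite ?retry_from_some ?retry_from_none ?retry_from_op //.
- by rewrite wp_ret addr_ge0// wp_ge0.
- by rewrite wp_ret /= big_seq1 mul1r lerD2l wp_leS.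
rewrite /= lerD2l ler_sum_answers// => x; apply: (le_trans (IH _)).
by apply: ler_wp => -[a|]//; rewrite lerD2l wp_leS.
Qed.

Definition unit_valued A (phi : A -> R) := forall a, 0 <= phi a <= 1.

Lemma unit_valued_ge0 A (phi : A -> R) : unit_valued phi -> forall a, 0 <= phi a.
Proof. by move=> u a; case/andP: (u a). Qed.

(* Executions which never end count as 0. The limit is only known to exist for a
   [0, 1]-valued phi. *)
Definition prob A (p : prog R V A) (phi : A -> R) : R :=
  limn (fun N => wp 0 N p phi).

Lemma cvg_prob A (p : prog R V A) phi : unit_valued phi ->
  wp 0 N p phi @[N --> \oo] --> prob p phi.
Proof.
move=> u; apply: nondecreasing_is_cvgn.
  by apply/nondecreasing_seqP => N; apply: wp_leS => //; exact: unit_valued_ge0.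
exists 1 => _ [N _ <-]; apply: wp_le_cst => // a.
by case/andP: (u a).
Qed.

Lemma wp_le_prob A N (p : prog R V A) phi : unit_valued phi ->
  wp 0 N p phi <= prob p phi.
Proof.
move=> u; apply: nondecreasing_cvgn_le; last exact: cvgP _ (cvg_prob u).
by apply/nondecreasing_seqP => n; apply: wp_leS => //; exact: unit_valued_ge0.
Qed.

Lemma prob_le A (p : prog R V A) phi x : unit_valued phi ->
  (forall N, wp 0 N p phi <= x) -> prob p phi <= x.
Proof. by move=> u le; apply: limr_le; [exact: cvgP _ (cvg_prob u)|near=> N].
Unshelve. all: by end_near. Qed.

Lemma prob_unit A B (f : A -> prog R V B) phi : unit_valued phi ->
  unit_valued (fun a => prob (f a) phi).
Proof.
move=> u a; apply/andP; split.
  apply: le_trans (wp_le_prob 0 (f a) u).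
  by apply: wp_ge0 => //; exact: unit_valued_ge0.
by apply: prob_le => // N; apply: wp_le_cst => // b; case/andP: (u b).
Qed.

Lemma prob_ret A (a : A) phi : unit_valued phi -> prob (Ret a) phi = phi a.
Proof.
move=> u; apply/eqP; rewrite eq_le; apply/andP; split.
  by apply: prob_le => // N; rewrite wp_ret.
exact: (wp_le_prob 0 (Ret a) u).
Qed.

Lemma prob_op A X (o : op R V X) (k : X -> prog R V A) phi : unit_valued phi ->
  prob (Op o k) phi = \sum_(xq <- answers G o) xq.2 * prob (k xq.1) phi.
Proof.
move=> u; apply/cvg_lim => //; rewrite -cvg_shiftS /=.
under eq_fun do rewrite add0r.
apply: cvg_big => [|xq _]; first exact: add_continuous.
by apply: cvgM; [exact: cvg_cst|exact: cvg_prob].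
Qed.

Lemma prob_ask A X (o : op R V X) (f : X -> prog R V A) phi : unit_valued phi ->
  prob (bind (ask o) f) phi = \sum_(xq <- answers G o) xq.2 * prob (f xq.1) phi.
Proof.
move=> u; rewrite /ask bind_op prob_op//.
by apply: eq_bigr => xq _; rewrite bind_ret.
Qed.

(** The two inequalities cut off different things: for the upper bound the whole retried run, for
    the lower bound only the first run [p], while the restart keeps its limit value. *)
Lemma prob_retry_from A (body p : prog R V (option A)) phi : unit_valued phi ->
  prob (retry_from body p) phi =
  prob p (fun r => if r is Some a then phi a else prob (retry body) phi).
Proof.
move=> u; have ur : unit_valued
    (fun r => if r is Some a then phi a else prob (retry body) phi).
  by move=> [a|]; [exact: u | exact: (prob_unit (fun _ : unit => retry body) u tt)].
apply/eqP; rewrite eq_le; apply/andP; split.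
  apply: prob_le => // N; apply: le_trans (wp_le_prob N p ur).
  apply: le_trans (wp_retry_from_le N body p (lexx 0) _) _.
    exact: unit_valued_ge0.
  by apply: ler_wp => -[a|]//; rewrite add0r wp_le_prob.
apply: prob_le => // N; elim: N p => [|N IH] [[a|]|X o k];
  rewrite ?retry_from_some ?retry_from_none ?retry_from_op //=.
- by rewrite prob_ret.
- by rewrite prob_op//= big_seq1 mul1r.
- by case/andP: (prob_unit (fun _ : unit => Op o (fun x => retry_from body (k x))) u tt).
- by rewrite prob_ret.
- by rewrite prob_op//= big_seq1 mul1r.
by rewrite prob_op// add0r ler_sum_answers.
Qed.

Lemma prob_lin A (p : prog R V A) (phi psi : A -> R) a :
  unit_valued phi -> unit_valued psi ->
  prob p (fun x => phi x + a * psi x) = prob p phi + a * prob p psi.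
Proof.
move=> uphi upsi; apply/cvg_lim => //.
rewrite (_ : (fun N => _) = (fun N => wp 0 N p phi + a * wp 0 N p psi)).
  by apply: cvgD; [exact: cvg_prob|apply: cvgM; [exact: cvg_cst|exact: cvg_prob]].
apply/funext => N; rewrite -wpZ mulr0 -wpD addr0//.
Qed.

(** * From cut-off expectations to the law of the running time *)

Lemma law_ge0 (A : eqType) (p : prog R V A) t a : 0 <= law G p t a.
Proof.
elim: t p => [|t IH] [b|X o k] //=.
by rewrite sum_answers_ge0.
Qed.

Lemma sum_law (A : eqType) (p : prog R V A) N a :
  \sum_(0 <= t < N.+1) law G p t a = wp 0 N p (fun b => (b == a)%:R).
Proof.
elim: N p => [|N IH] [b|X o k].
- by rewrite big_nat1.
- by rewrite big_nat1.
- rewrite big_nat_recl// big1 => [|t _]; by rewrite /= ?addr0.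
rewrite big_nat_recl//= !add0r exchange_big/=.
by apply: eq_bigr => xq _; rewrite -IH mulr_sumr.
Qed.

Lemma wp_sum (A : Type) (I : finType) N (p : prog R V A) (phi : I -> A -> R) :
  wp 0 N p (fun a => \sum_i phi i a) = \sum_i wp 0 N p (phi i).
Proof.
elim: N p => [|N IH] [b|X o k] //=; first by rewrite big1.
rewrite add0r; under [RHS]eq_bigr do rewrite add0r.
by rewrite exchange_big/=; apply: eq_bigr => xq _; rewrite IH mulr_sumr.
Qed.

Lemma sum_law_total (A : finType) (p : prog R V A) N :
  \sum_(0 <= t < N.+1) \sum_(a : A) law G p t a = wp 0 N p (fun=> 1).
Proof.
rewrite exchange_big/=; under eq_bigr do rewrite sum_law.
rewrite -wp_sum; congr wp; apply/funext => b.
by rewrite (bigD1 b)//= eqxx big1 ?addr0// => i; rewrite eq_sym => /negbTE ->.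
Qed.

(** Executions that are lost or still running at the cutoff pay for their steps on the right only,
    hence an inequality. *)
Lemma sum_time_law (A : finType) (p : prog R V A) N :
  \sum_(0 <= t < N.+1) t%:R * (\sum_(a : A) law G p t a) <= wp 1 N p (fun=> 0).
Proof.
elim: N p => [|N IH] [b|X o k].
- by rewrite big_nat1 mul0r.
- by rewrite big_nat1 mul0r.
- rewrite big_nat_recl// mul0r add0r big1 => [|t _] //=.
  by rewrite big1 ?mulr0.
rewrite big_nat_recl// mul0r add0r /=.
(* The factor t + 1 splits into the time t of the continuation and one unit for the first
   instruction, the latter weighted by the probability that the continuation ends within [N]
   steps. *)
have -> : \sum_(0 <= t < N.+1) t.+1%:R * (\sum_a \sum_(xq <- answers G o)
      xq.2 * law G (k xq.1) t a) =
    \sum_(xq <- answers G o) xq.2 *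
      ((\sum_(0 <= t < N.+1) t%:R * (\sum_a law G (k xq.1) t a)) +
       wp 0 N (k xq.1) (fun=> 1)).
  under eq_bigr do rewrite exchange_big/= mulr_sumr.
  rewrite exchange_big/=; apply: eq_bigr => xq _.
  rewrite -sum_law_total -big_split mulr_sumr; apply: eq_bigr => t _ /=.
  rewrite -mulr_sumr -natr1; ring.
have -> : 1 + \sum_(xq <- answers G o) xq.2 * wp 1 N (k xq.1) (fun=> 0) =
    \sum_(xq <- answers G o) xq.2 * wp 1 N (k xq.1) (fun=> 0) + 1 by rewrite addrC.
under eq_bigr do rewrite mulrDr.
rewrite big_split lerD//=.
  by rewrite ler_sum_answers.
by rewrite sum_answers_le// => xq; exact: wp_le_cst.
Qed.

Lemma output_probE (A : eqType) (p : prog R V A) a :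
  output_prob G p a = (prob p (fun b => (b == a)%:R))%:E.
Proof.
apply/cvg_lim => //; rewrite -cvg_shiftS.
under eq_fun do rewrite sumEFin sum_law.
apply: cvg_EFin; first by near=> N.
by apply: cvg_prob => b; case: eqP => _ /=; rewrite ?lexx ?ler01.
Unshelve. all: by end_near. Qed.

Lemma terminates_asE (A : finType) (p : prog R V A) :
  prob p (fun=> 1) = 1 -> terminates_as G p.
Proof.
move=> p1; apply/cvg_lim => //; rewrite -cvg_shiftS.
under eq_fun do rewrite sumEFin sum_law_total.
apply: cvg_EFin; first by near=> N.
by rewrite -[X in _ --> X]p1; apply: cvg_prob => b; rewrite ler01 lexx.
Unshelve. all: by end_near. Qed.

Lemma expected_time_le (A : finType) (p : prog R V A) C :
  (forall N, wp 1 N p (fun=> 0) <= C) -> (expected_time G p <= C%:E)%E.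
Proof.
move=> wpC; apply: lime_le.
  apply: is_cvg_nneseries => n _ _; rewrite lee_fin mulr_ge0// sumr_ge0// => a _.
  exact: law_ge0.
near=> N; rewrite sumEFin lee_fin; apply: le_trans (wpC N).
apply: le_trans (sum_time_law p N).
rewrite big_nat_recr//= lerDl mulr_ge0// sumr_ge0// => a _.
exact: law_ge0.
Unshelve. all: by end_near. Qed.

End Expectation.

(** * Restarting a body until it succeeds *)

Section Retry.
Context (R : realType) (V : finType) (G : graph V) (A : Type).
Variable body : prog R V (option A).

Definition lift_some (phi : A -> R) (r : option A) : R :=
  if r is Some a then phi a else 0.

Lemma unit_valued_lift phi : unit_valued phi -> unit_valued (lift_some phi).
Proof. by move=> u [a|] /=; rewrite ?lexx ?ler01. Qed.

Let is_none (r : option A) : R := (~~ r)%:R.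

Let unit_none : unit_valued is_none.
Proof. by case=> [a|]; rewrite /is_none /= ?lexx ler01. Qed.

Hypothesis body1 : prob G body (fun=> 1) = 1.

Let prob_none : prob G body is_none = 1 - prob G body (lift_some (fun=> 1)).
Proof.
apply/eqP; rewrite eq_sym subr_eq addrC; apply/eqP.
rewrite -[X in _ + X]mul1r -prob_lin//; last first.
  by apply: unit_valued_lift => a; rewrite ler01 lexx.
rewrite -[LHS]body1; congr prob; apply/funext => -[a|] /=.
  by rewrite /is_none mulr0 addr0.
by rewrite /is_none mulr1 add0r.
Qed.

(* Solves X = s + X (1 - p), where p is the success probability of the body. *)
Lemma prob_retry (phi : A -> R) : unit_valued phi ->
  prob G (retry body) phi * prob G body (lift_some (fun=> 1)) =
  prob G body (lift_some phi).
Proof.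
move=> u; set X := prob G (retry body) phi.
have : X = prob G body (lift_some phi) + X * prob G body is_none.
  rewrite -prob_lin//; last exact: unit_valued_lift.
  rewrite {1}/X /retry prob_retry_from//; congr prob; apply/funext => -[a|].
    by rewrite /is_none mulr0 addr0.
  by rewrite /is_none mulr1 add0r.
rewrite prob_none; set s := prob G body _; set t := prob G body _.
by move=> XE; rewrite -[LHS](addrK (X * (1 - t))) [_ + X * _]addrC -mulrDr
  addrNK mulr1 {1}XE addrK.
Qed.

(** A failure costs one step and a fresh start, so Y <= K + (1 + Y) (1 - t) for the success
    probability t, that is, Y t <= K + (1 - t). *)
Lemma wp_retry_le (K : R) N : (forall N, wp G 1 N body (fun=> 0) <= K) ->
  wp G 1 N (retry body) (fun=> 0) * prob G body (lift_some (fun=> 1)) <= K + 1.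
Proof.
move=> bodyK; set Y := wp G 1 N (retry body) _.
have Y0 : 0 <= Y by exact: wp_ge0.
have : Y <= K + (1 + Y) * prob G body is_none.
  apply: le_trans (wp_retry_from_le G N body body ler01 (fun=> lexx 0)) _.
  rewrite (_ : (fun r => _) = (fun r => 0 + (1 + Y) * is_none r)); last first.
    apply/funext => -[a|]; rewrite /is_none /= ?mulr0 ?add0r// mulr1//.
  rewrite -[X in wp G X](addr0 1) wpD lerD//.
  rewrite -{1}(mulr0 (1 + Y)) wpZ ler_wpM2l ?addr_ge0//.
  exact: wp_le_prob.
rewrite prob_none; set t := prob G body _.
have : 0 <= t.
  apply: le_trans (wp_le_prob _ 0 _ _); last first.
    by apply: unit_valued_lift => a; rewrite ler01 lexx.
  by apply: wp_ge0 => // -[a|] /=.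
by move=> t0 le; lra.
Qed.

End Retry.

(** * Execution of non-random steps *)

Section Deterministic.
Context (R : realType) (V : finType) (G : graph V).

(* p continues as q after at most c steps, none of which is random. *)
Inductive reduces (A : Type) : prog R V A -> prog R V A -> nat -> Prop :=
  | reduces_refl p c : reduces p p c
  | reduces_op X (o : op R V X) x k q c : answers G o = [:: (x, 1)] ->
      reduces (k x) q c -> reduces (Op o k) q c.+1.

Local Notation det p a c := (reduces p (Ret a) c).

Lemma reduces_le A (p q : prog R V A) c c' :
  reduces p q c -> (c <= c')%N -> reduces p q c'.
Proof.
move=> pqc; elim: pqc c' => [r d c' _|X o x k r d ox _ IH [//|c'] dc'].
  exact: reduces_refl.
by apply: (reduces_op ox); exact: IH.
Qed.

Lemma reduces_trans A (p q r : prog R V A) c d :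
  reduces p q c -> reduces q r d -> reduces p r (c + d).
Proof.
elim=> {p q c} [p c|X o x k q c ox _ IH] qr.
  by apply: reduces_le qr _; rewrite leq_addl.
by apply: (reduces_op ox); exact: IH.
Qed.

Lemma reduces_bind A B (p q : prog R V A) (f : A -> prog R V B) c :
  reduces p q c -> reduces (bind p f) (bind q f) c.
Proof.
elim=> {p q c} [p c|X o x k q c ox _ IH]; first exact: reduces_refl.
by rewrite bind_op; exact: (reduces_op ox).
Qed.

Lemma det_bind A B (p : prog R V A) (f : A -> prog R V B) a q c d :
  det p a c -> reduces (f a) q d -> reduces (bind p f) q (c + d).
Proof.
move=> /reduces_bind - /(_ _ f); rewrite bind_ret; exact: reduces_trans.
Qed.

Lemma det_ask X (o : op R V X) x : answers G o = [:: (x, 1)] -> det (ask o) x 1.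
Proof. by move=> ox; apply: (reduces_op ox); exact: reduces_refl. Qed.

Lemma det_compute X (x : X) : det (compute x) x 1.
Proof. exact: det_ask. Qed.

Lemma det_mapM (A : eqType) B (f : A -> prog R V B) (g : A -> B) (c : A -> nat) s :
  (forall a, a \in s -> det (f a) (g a) (c a)) ->
  det (mapM f s) (map g s) (\sum_(a <- s) c a)%N.
Proof.
elim: s => [|a s IH] fg /=; first exact: reduces_refl.
rewrite big_cons; apply: det_bind; first by apply: fg; rewrite mem_head.
rewrite -[X in reduces _ _ X]addn0; apply: det_bind; last exact: reduces_refl.
by apply: IH => b bs; apply: fg; rewrite in_cons bs orbT.
Qed.

Lemma det_sumM A (F : A -> R) (s : seq A) :
  det (sumM F s) (\sum_(a <- s) F a) (size s).
Proof.
elim: s => [|a s IH] /=; first by rewrite big_nil; exact: reduces_refl.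
by rewrite big_cons -addn1; apply: det_bind IH _; exact: det_compute.
Qed.

Lemma det_tabulate T (x0 : T) (f : V -> prog R V T) g c :
  (forall v, det (f v) (g v) (c v)) ->
  det (tabulate x0 f) g (\sum_v c v)%N.
Proof.
move=> fg; rewrite -big_enum -[X in reduces _ _ X]addn0.
apply: det_bind; first by apply: det_mapM => v _; exact: fg.
rewrite (_ : (fun v => _) = g); first exact: reduces_refl.
apply/funext => v; rewrite (nth_map v) ?nth_enum_rank//.
by rewrite -cardE; exact: ltn_ord.
Qed.

Lemma prob_reduces A (p q : prog R V A) c phi :
  unit_valued phi -> reduces p q c -> prob G p phi = prob G q phi.
Proof.
move=> u; elim=> {p q c} [//|X o x k q c ox _ IH].
by rewrite prob_op// ox big_seq1 mul1r IH.
Qed.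

Lemma wp_reduces A (p q : prog R V A) c N phi :
  (forall a, 0 <= phi a) -> reduces p q c ->
  wp G 1 N p phi <= c%:R + wp G 1 N q phi.
Proof.
move=> phi0 pq; elim: pq N => {p q c} [p c|X o x k q c ox _ IH] N.
  by rewrite lerDr.
case: N => [|N] /=; first by rewrite addr_ge0// (@wp_ge0 _ _ G 1 _ 0).
rewrite ox big_seq1 mul1r -natr1 [_ + 1]addrC -addrA lerD2l.
by apply: le_trans (IH N) _; rewrite lerD2l wp_leS.
Qed.

End Deterministic.

(** * The truncated random walk *)

Section GraphSums.
Context (R : realType) (V : finType) (G : graph V).

Lemma size_nbrs v : size (nbrs G v) = degree G v.
Proof.
rewrite /degree -(card_uniqP (nbrs_uniq G v)).
by apply: eq_card => w; rewrite inE mem_nbrs.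
Qed.

Lemma big_nbrs (T : Type) (idx : T) (op : Monoid.com_law idx) v (F : V -> T) :
  \big[op/idx]_(w <- nbrs G v) F w = \big[op/idx]_(w | adj G v w) F w.
Proof.
rewrite -[RHS]big_filter; apply: perm_big; apply: uniq_perm.
- exact: nbrs_uniq.
- exact: filter_uniq (index_enum_uniq _).
by move=> w; rewrite mem_nbrs mem_filter mem_index_enum andbT.
Qed.

Lemma big_edges (T : Type) (idx : T) (op : Monoid.com_law idx) (F : V * V -> T) :
  \big[op/idx]_(e in edges G) F e =
  \big[op/idx]_v \big[op/idx]_(w <- nbrs G v) F (v, w).
Proof.
under [RHS]eq_bigr do rewrite big_nbrs.
by rewrite pair_big_dep; apply: eq_big => [[v w]|[v w] _]//; rewrite inE.
Qed.

Lemma exchange_nbrs (F : V -> V -> R) :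
  \sum_v \sum_(w <- nbrs G v) F v w = \sum_w \sum_(v <- nbrs G w) F v w.
Proof.
under eq_bigr do rewrite big_nbrs.
under [RHS]eq_bigr do rewrite big_nbrs.
rewrite (exchange_big_dep xpredT)//=; apply: eq_bigr => w _.
by apply: eq_bigl => v; exact: adj_sym.
Qed.

Lemma card_edges : #|edges G| = (\sum_v degree G v)%N.
Proof.
rewrite -sum1_card big_edges; apply: eq_bigr => v _.
by rewrite sum1_size size_nbrs.
Qed.

End GraphSums.

(** The index drawn may exceed the length of the list; each surplus index finds no neighbor and
    contributes [F None]. *)
Lemma sum_iota_onth (R : realType) (T : Type) (s : seq T) (F : option T -> R) k :
  (size s <= k)%N ->
  \sum_(i <- iota 1 k) F (if i is j.+1 then onth s j else None) =
  \sum_(x <- s) F (Some x) + (k - size s)%:R * F None.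
Proof.
move=> sk; rewrite -[in LHS](addn0 1%N) iotaDl big_map /=.
elim: s k sk => [|x s IH] [|k]// sk.
- by rewrite !big_nil mul0r addr0.
- rewrite big_nil add0r subn0 mulr_natl.
  rewrite (eq_bigr (fun=> F None)) => [|[|i]//].
  by rewrite big_const_seq count_predT size_iota iter_addr_0.
by rewrite /= -[1%N]addn0 iotaDl !big_cons big_map -addrA IH.
Qed.

(** * Law of an attempt and of a round *)

Section Walks.
Context (R : realType) (V : finType) (G : graph V) (theta : nat).
Implicit Types (phi : V * V -> R) (f g : V -> R).

Definition heavy v := (theta < degree G v)%N.

(* The transition operator of the walk: the mean of phi after one more step,
   where the walk dies when it leaves a light vertex. *)
Definition walk_step phi (e : V * V) : R :=
  if heavy e.2 then
    (degree G e.2)%:R^-1 * \sum_(w <- nbrs G e.2) phi (e.2, w)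
  else 0.

Definition heavy_mean f v : R :=
  if heavy v then (degree G v)%:R^-1 * \sum_(w <- nbrs G v) f w else 0.

Lemma prob_walk s u' u phi : unit_valued phi ->
  prob G (walk R theta s u' u) (lift_some phi) = iter s (walk_step) phi (u', u).
Proof.
move=> uphi; have ul := unit_valued_lift uphi.
elim: s u' u => [|s IH] u' u; first by rewrite /= prob_ret.
rewrite iterS {1}/walk_step /heavy /= prob_ask//= big_seq1 mul1r /=.
case: leqP => [_|hu]; first by rewrite prob_ret.
rewrite prob_ask//= big_map -mulr_sumr; congr (_ * _).
under [LHS]eq_bigr do rewrite prob_ask//= big_seq1 mul1r /=.
rewrite (@sum_iota_onth _ _ (nbrs G u) (fun r => prob G (if r is Some w
  then walk R theta s u w else Ret None) (lift_some phi))) ?size_nbrs//.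
rewrite subnn mul0r addr0; apply: eq_bigr => w _; exact: IH.
Qed.

(** A light [u0] has at most [theta] neighbors, so each of them is chosen with probability 1 / theta
    whatever the degree; the surplus indices fail and contribute nothing to [lift_some phi]. *)
Lemma prob_attempt k phi : unit_valued phi -> (0 < theta)%N ->
  prob G (sampling_attempt R V theta k.+1) (lift_some phi) =
  (#|V|%:R * theta%:R)^-1 *
  \sum_v (~~ heavy v)%:R * \sum_(w <- nbrs G v) iter k walk_step phi (v, w).
Proof.
move=> uphi theta0; have ul := unit_valued_lift uphi.
rewrite prob_ask//= big_map big_enum/= invfM -mulrA -mulr_sumr; congr (_ * _).
rewrite mulr_sumr; apply: eq_bigr => v _.
rewrite prob_ask//= big_seq1 mul1r /= /heavy -leqNgt.
case: leqP => [dv|hv]; last by rewrite prob_ret//= mul0r mulr0.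
rewrite prob_ask//= big_map -mulr_sumr mul1r; congr (_ * _).
under [LHS]eq_bigr do rewrite prob_ask//= big_seq1 mul1r /=.
rewrite (@sum_iota_onth _ _ (nbrs G v) (fun r => prob G (if r is Some w
  then walk R theta k v w else Ret None) (lift_some phi))) ?size_nbrs//.
rewrite prob_ret//= mulr0 addr0; apply: eq_bigr => w _; exact: prob_walk.
Qed.

(* [heavy_mean] is adjoint to [walk_step]. *)
Lemma sum_walk_step g phi :
  \sum_v g v * \sum_(w <- nbrs G v) walk_step phi (v, w) =
  \sum_v heavy_mean g v * \sum_(w <- nbrs G v) phi (v, w).
Proof.
under eq_bigr do rewrite mulr_sumr.
rewrite exchange_nbrs; apply: eq_bigr => v _; rewrite /walk_step /heavy_mean /=.
rewrite -mulr_suml; case: ifP => _; last by rewrite mulr0 mul0r.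
by rewrite mulrCA mulrA.
Qed.

(** Moving all [k] steps to the side of [g] leaves the plain sum of [phi] over the edges leaving
    [v], so an edge is weighted according to its tail alone. *)
Lemma sum_iter_walk_step k g phi :
  \sum_v g v * \sum_(w <- nbrs G v) iter k walk_step phi (v, w) =
  \sum_v iter k heavy_mean g v * \sum_(w <- nbrs G v) phi (v, w).
Proof.
elim: k g => [//|k IH] g; rewrite iterS sum_walk_step IH.
by apply: eq_bigr => v _; rewrite -iterSr.
Qed.

Lemma heavy_meanB f g :
  heavy_mean (fun v => f v - g v) = (fun v => heavy_mean f v - heavy_mean g v).
Proof.
apply/funext => v; rewrite /heavy_mean; case: ifP => _; last by rewrite subrr.
by rewrite sumrB mulrBr.
Qed.

Lemma heavy_mean1 v : heavy_mean (fun=> 1) v = (heavy v)%:R.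
Proof.
rewrite /heavy_mean; case: ifP => // hv.
rewrite big_const_seq count_predT size_nbrs iter_addr_0 mulVf//.
by rewrite pnatr_eq0 -lt0n (leq_ltn_trans _ hv).
Qed.

(* With the operator B = heavy_mean, the light vertices have indicator
   1 - B 1, so the contributions B^k (1 - B 1) of the rounds telescope. *)
Lemma iter_heavy_mean_light k :
  iter k heavy_mean (fun v => (~~ heavy v)%:R) =
  (fun v => iter k heavy_mean (fun=> 1) v - iter k.+1 heavy_mean (fun=> 1) v).
Proof.
elim: k => [|k IH]; last by rewrite iterS IH heavy_meanB.
by apply/funext => v; rewrite /= heavy_mean1; case: heavy; rewrite ?subrr ?subr0.
Qed.

Definition one_round l : prog R V (option (V * V)) :=
  bind (ask (Unif l)) (fun k => sampling_attempt R V theta k).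

Lemma prob_one_round l phi : unit_valued phi -> (0 < theta)%N ->
  prob G (one_round l) (lift_some phi) =
  (l%:R * (#|V|%:R * theta%:R))^-1 *
  \sum_v (1 - iter l heavy_mean (fun=> 1) v) * \sum_(w <- nbrs G v) phi (v, w).
Proof.
move=> uphi theta0; rewrite prob_ask; last exact: unit_valued_lift.
rewrite /= big_map -mulr_sumr -[in iota _ _](addn0 1%N) iotaDl big_map /=.
under eq_bigr do rewrite prob_attempt// sum_iter_walk_step iter_heavy_mean_light.
rewrite -mulr_sumr exchange_big [(l%:R * _)^-1]invfM -mulrA; congr (_ * (_ * _)).
apply: eq_bigr => v _; rewrite -mulr_suml; congr (_ * _).
(* The range 0, ..., l - 1 is put in the form of [index_iota], and a negation orients the
   differences as [telescope_sumr] expects. *)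
rewrite -[iota 0 l]/(iota 0 l) -{1}[l]subn0 -/(index_iota 0 l).
rewrite -[LHS]opprK -sumrN; under eq_bigr do rewrite opprB.
by rewrite telescope_sumr// opprB.
Qed.

(** * Almost sure termination of a round *)

Lemma prob_ask1 A X (o : op R V X) (f : X -> prog R V A) :
  \sum_(xq <- answers G o) xq.2 = 1 ->
  (forall x, prob G (f x) (fun=> 1) = 1) ->
  prob G (bind (ask o) f) (fun=> 1) = 1.
Proof.
move=> o1 f1; rewrite prob_ask; last by move=> a; rewrite ler01 lexx.
by under eq_bigr do rewrite f1 mulr1.
Qed.

Lemma answers_unif k : (0 < k)%N ->
  \sum_(xq <- answers G (@Unif R V k)) xq.2 = 1.
Proof.
move=> k0; rewrite big_map big_const_seq count_predT size_iota iter_addr_0.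
by rewrite -[_ *+ _]mulr_natr mulVf// pnatr_eq0 -lt0n.
Qed.

Lemma prob_ret1 A (a : A) : prob G (Ret a) (fun=> 1 : R) = 1.
Proof. by rewrite prob_ret// => b; rewrite ler01 lexx. Qed.

Lemma prob_walk1 s u' u : prob G (walk R theta s u' u) (fun=> 1) = 1.
Proof.
elim: s u' u => [|s IH] u' u; first exact: prob_ret1.
have u1 : unit_valued (fun=> 1 : R) by move=> A a; rewrite ler01 lexx.
rewrite prob_ask//= big_seq1 mul1r /=; case: leqP => [_|hu]; first exact: prob_ret1.
apply: prob_ask1 => [|i]; first by apply: answers_unif; exact: leq_ltn_trans hu.
by apply: prob_ask1 => [|[w|]]; [rewrite big_seq1|exact: IH|exact: prob_ret1].
Qed.

Lemma prob_one_round1 l : (0 < #|V|)%N -> (0 < theta)%N -> (0 < l)%N ->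
  prob G (one_round l) (fun=> 1) = 1.
Proof.
move=> V0 theta0 l0; apply: prob_ask1 => [|k]; first exact: answers_unif.
apply: prob_ask1 => [|v].
  rewrite big_map big_const_seq count_predT -cardE iter_addr_0.
  by rewrite -[_ *+ _]mulr_natr mulVf// pnatr_eq0 -lt0n.
apply: prob_ask1 => [|d]; first by rewrite big_seq1.
case: ifP => _; first exact: prob_ret1.
apply: prob_ask1 => [|j]; first exact: answers_unif.
by apply: prob_ask1 => [|[w|]]; [rewrite big_seq1|exact: prob_walk1|exact: prob_ret1].
Qed.

End Walks.

(** * Scarcity of heavy vertices and the cost of a round *)

Section Bounds.
Context (R : realType) (V : finType) (G : graph V) (theta : nat).
Hypothesis theta_large : (2 * #|edges G| <= theta ^ 2)%N.
Local Notation heavy := (heavy G theta).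
Local Notation B := (@heavy_mean R V G theta).

(* The degrees of the heavy vertices sum to at most m <= theta^2 / 2, so fewer
   than theta / 2 vertices are heavy. *)
Lemma double_heavy_nbrs v : heavy v ->
  (2 * count heavy (nbrs G v) <= degree G v)%N.
Proof.
move=> hv; apply: (@leq_trans theta.+1) => //.
have : (count heavy (nbrs G v) * theta.+1 <= #|edges G|)%N.
  rewrite card_edges -sum1_count big_distrl big_mkcond big_nbrs big_mkcond/=.
  apply: leq_sum => w _; case: ifP => // _; case: ifP => // hw.
  by rewrite mul1n.
nia.
Qed.

Let count_le v : heavy v ->
  (degree G v)%:R^-1 * (count heavy (nbrs G v))%:R <= 2^-1 :> R.
Proof.
move=> hv; have d0 : (0 < degree G v)%N by exact: leq_ltn_trans hv.
rewrite mulrC ler_pdivrMr ?ltr0n// ler_pdivlMl// -natrM ler_nat.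
exact: double_heavy_nbrs.
Qed.

(** The first application of B gives the indicator of the heavy vertices. Each further one averages
    a function that vanishes on light vertices, hence on at least half of the neighbors, and so
    halves the bound. *)
Lemma iter_heavy_mean_bounds j v :
  0 <= iter j.+1 B (fun=> 1) v <= (heavy v)%:R * 2 ^- j.
Proof.
elim: j v => [|j IH] v; first by rewrite expr0 invr1 iterS heavy_mean1 mulr1 lexx ler0n.
rewrite iterS; set f := iter j.+1 B _; rewrite /heavy_mean.
case: ifP => hv; last by rewrite mul0r lexx.
apply/andP; split.
  by rewrite mulr_ge0 ?invr_ge0 ?ler0n// sumr_ge0// => w _; case/andP: (IH w).
rewrite mul1r exprS invfM; apply: le_trans (ler_wpM2r _ (count_le hv)); last first.
  by rewrite invr_ge0 exprn_ge0.
rewrite -mulrA ler_wpM2l ?invr_ge0// -sum1_count natr_sum mulr_suml.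
rewrite [leRHS]big_mkcond/=; apply: ler_sum => w _; case/andP: (IH w) => _.
by case: heavy; rewrite ?mul0r.
Qed.

(** A heavy vertex costs three instructions and is followed by a heavy one with probability at most
    1/2, so 7 solves x = 3 + (x + 1) / 2; a light vertex costs its degree query only. *)
Lemma wp_walk N s u' u :
  wp G 1 N (walk R theta s u' u) (fun=> 0) <= if heavy u then 7 else 1.
Proof.
elim: s u' u => [|s IH] u' u; first by rewrite wp_ret; case: heavy.
apply: le_trans (wp_ask_le _ _ _ _ _ _) _ => //=.
rewrite big_seq1 mul1r /= /heavy; case: leqP => [_|hu]; first by rewrite wp_ret addr0.
have d0 : (degree G u)%:R != 0 :> R by rewrite pnatr_eq0 -lt0n (leq_ltn_trans _ hu).
(* The three units are the degree query, the random index and the neighbor query; the summand at [w]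
   is the induction hypothesis, 7 or 1, as one formula. *)
apply: (@le_trans _ _ (1 + (1 + (1 +
    (degree G u)%:R^-1 * \sum_(w <- nbrs G u) (1 + 6 * (heavy w)%:R))))).
  rewrite lerD2l; apply: le_trans (wp_ask_le _ _ _ _ _ _) _ => //.
  rewrite lerD2l/= big_map/= -mulr_sumr.
  apply: (@le_trans _ _ ((degree G u)%:R^-1 *
      (\sum_(w <- nbrs G u) (1 + (1 + 6 * (heavy w)%:R))))).
    rewrite ler_wpM2l ?invr_ge0//.
    pose F (r : option V) := if r is Some w then 1 + (1 + 6 * (heavy w)%:R) else 1 : R.
    have := @sum_iota_onth R V (nbrs G u) F (degree G u).
    rewrite size_nbrs subnn mul0r addr0 => /(_ (leqnn _)) <-.
    apply: ler_sum => i _; apply: le_trans (wp_ask_le _ _ _ _ _ _) _ => //=.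
    rewrite big_seq1 mul1r /=.
    move: (if i is j.+1 then onth (nbrs G u) j else None) => [w|] /=.
      rewrite lerD2l; apply: le_trans (IH _ _) _.
      by case: heavy; rewrite ?mulr0 ?mulr1; lra.
    by rewrite wp_ret addr0.
  rewrite big_split/= mulrDr lerD2r.
  by rewrite big_const_seq count_predT size_nbrs iter_addr_0 mulVf.
rewrite big_split/= big_const_seq count_predT size_nbrs iter_addr_0 mulrDr mulVf//.
rewrite -mulr_sumr mulrCA; have := count_le hu.
rewrite -sum1_count natr_sum [X in _ * X]big_mkcond/=.
rewrite (eq_bigr (fun w => (heavy w)%:R)) => [|w _]; last by case: heavy.
set x := _ * _; lra.
Qed.

Lemma wp_ask_bound A X N (o : op R V X) (f : X -> prog R V A) K : 0 <= K ->
  (forall x, wp G 1 N (f x) (fun=> 0) <= K) ->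
  wp G 1 N (bind (ask o) f) (fun=> 0) <= K + 1.
Proof.
move=> K0 fK; apply: le_trans (wp_ask_le _ _ _ _ _ _) _ => //.
by rewrite addrC lerD2r sum_answers_le.
Qed.

(** Five instructions (for [k], [u0], its degree, [j] and [u1]) precede a walk of cost at most 7. *)
Lemma wp_one_round N l : wp G 1 N (one_round R V theta l) (fun=> 0) <= 12.
Proof.
rewrite (_ : 12 = 11 + 1); last by ring.
apply: wp_ask_bound => // k; rewrite (_ : 11 = 10 + 1); last by ring.
apply: wp_ask_bound => // v; rewrite (_ : 10 = 9 + 1); last by ring.
apply: wp_ask_bound => // d; case: ifP => _; first by rewrite wp_ret.
rewrite (_ : 9 = 8 + 1); last by ring.
apply: wp_ask_bound => // j; rewrite (_ : 8 = 7 + 1); last by ring.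
apply: wp_ask_bound => // -[w|]; last by rewrite wp_ret.
by apply: le_trans (wp_walk _ _ _ _) _; case: heavy; rewrite ?ler1n.
Qed.

End Bounds.

(** * The fallback *)

Section Fallback.
Context (R : realType) (V : finType) (G : graph V).
Local Notation det p a c := (reduces G p (Ret a) c).

Definition edge_list :=
  flatten [seq [seq (v, w) | w <- nbrs G v] | v <- enum V].

Lemma big_edge_list (T : Type) (idx : T) (op : Monoid.com_law idx) (F : V * V -> T) :
  \big[op/idx]_(e <- edge_list) F e =
  \big[op/idx]_v \big[op/idx]_(w <- nbrs G v) F (v, w).
Proof.
rewrite big_flatten big_map big_enum/=.
by apply: eq_bigr => v _; rewrite big_map.
Qed.

Lemma size_edge_list : size edge_list = #|edges G|.
Proof.
rewrite card_edges -sum1_size big_edge_list.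
by apply: eq_bigr => v _; rewrite sum1_size size_nbrs.
Qed.

Lemma pmap_onth (T : Type) (s : seq T) :
  pmap id [seq (if i is j.+1 then onth s j else None) | i <- iota 1 (size s)] = s.
Proof.
rewrite -[in iota _ _](addn0 1%N) iotaDl -map_comp /=.
elim: s => //= x s IH; rewrite -[1%N]addn0 iotaDl -map_comp; congr cons.
exact: IH.
Qed.

Lemma det_neighbor_lists :
  det (tabulate [::] (fun v => let* d := ask (@Degree R V v) in
    let* r := mapM (fun j => ask (Neighbor v j)) (iota 1 d) in Ret (pmap id r)))
    (nbrs G) (#|V| + #|edges G|).
Proof.
rewrite card_edges -sum1_card -big_split; apply: det_tabulate => v.
apply: det_bind; first exact: det_ask.
rewrite -[X in reduces _ _ _ X]addn0.
apply: det_bind.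
  rewrite -[X in reduces _ _ _ X](size_iota 1) -sum1_size.
  by apply: det_mapM => j _; exact: det_ask.
rewrite -size_nbrs pmap_onth; exact: reduces_refl.
Qed.

Lemma det_heavy_lists theta :
  det (tabulate [::] (fun v =>
      let* b := mapM (fun w => @compute R V _ (theta < size (nbrs G w))%N) (nbrs G v) in
      Ret (mask b (nbrs G v))))
    (fun v => [seq w <- nbrs G v | heavy G theta w]) #|edges G|.
Proof.
rewrite card_edges; apply: det_tabulate => v; rewrite -[X in reduces _ _ _ X]addn0.
rewrite -size_nbrs -sum1_size.
apply: det_bind; first by apply: det_mapM => w _; exact: det_compute.
rewrite (eq_map (_ : _ =1 heavy G theta)) => [|w]; last by rewrite size_nbrs.
rewrite -filter_mask; exact: reduces_refl.
Qed.

(* The phases compute h_{v,j} = B^(j+1) 1 v, for B = heavy_mean. *)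
Lemma det_h_phases theta i : exists2 h,
  det (h_phases R theta (nbrs G) (fun v => [seq w <- nbrs G v | heavy G theta w]) i)
    h (i * (#|V| + #|edges G|)) &
  forall j v, (0 < j <= i)%N ->
    h j v = iter j.+1 (@heavy_mean R V G theta) (fun=> 1) v.
Proof.
elim: i => [|i [h hdet hE]].
  by exists (fun _ _ => 0); [exact: reduces_refl|case].
pose H := iter i.+2 (@heavy_mean R V G theta) (fun=> 1).
exists (fun j => if j == i.+1 then H else h j); last first.
  move=> j v /andP[j0]; rewrite leq_eqVlt ltnS; case: eqP => [->//|_] /= ji.
  by apply: hE; rewrite j0.
rewrite mulSn addnC; apply: det_bind hdet _; rewrite -[X in reduces _ _ _ X]addn0.
apply: det_bind; last exact: reduces_refl.
rewrite card_edges -sum1_card -big_split; apply: det_tabulate => v.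
rewrite leqNgt size_nbrs -/(heavy G theta v) /H iterS.
set f := iter i.+1 _ _; rewrite /heavy_mean; case hv: (heavy G theta v); last first.
  by apply: reduces_le (det_compute _ _ _) _; rewrite leq_addr.
(* All iterates vanish at light vertices, so the sums over all neighbors in [heavy_mean] agree with
   the sums of the program over heavy neighbors. *)
have sumE (g : V -> R) : (forall w, ~~ heavy G theta w -> g w = 0) ->
    \sum_(w <- nbrs G v) g w = \sum_(w <- nbrs G v | heavy G theta w) g w.
  move=> g0; rewrite [RHS]big_mkcond; apply: eq_bigr => w _.
  by case: ifPn => // /g0.
have light0 k w : ~~ heavy G theta w ->
    iter k.+1 (@heavy_mean R V G theta) (fun=> 1) w = 0.
  by rewrite iterS /heavy_mean => /negbTE ->.
have h1E : (degree G v)%:R^-1 *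
    \sum_(w <- nbrs G v) iter 1 (@heavy_mean R V G theta) (fun=> 1) w =
    (size [seq w <- nbrs G v | heavy G theta w])%:R / (degree G v)%:R :> R.
  rewrite sumE; last exact: light0.
  rewrite mulrC -sum1_size big_filter natr_sum; congr (_ / _).
  by apply: eq_bigr => w hw; rewrite iterS heavy_mean1 hw.
rewrite /f; case: (eqVneq i 0%N) => [->|i0].
  rewrite h1E; apply: reduces_le (det_compute _ _ _) _.
  by rewrite leq_addr.
(* One step per heavy neighbor and one for the product fit in the budget 1 + d(v) of a vertex. *)
have le_d : (size [seq w <- nbrs G v | heavy G theta w] + 1 <= 1 + degree G v)%N.
  by rewrite addnC leq_add2l -size_nbrs size_filter count_size.
apply: reduces_le le_d; apply: det_bind; first exact: det_sumM.
set s := (X in Ret X).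
rewrite (_ : s = h 1%N v *
    ((\sum_(w <- [seq w <- nbrs G v | heavy G theta w]) h i w) /
     (size [seq w <- nbrs G v | heavy G theta w])%:R)); first exact: det_compute.
rewrite hE ?lt0n// [iter 2 _ _]iterS /heavy_mean hv h1E /s.
rewrite sumE; last exact: light0.
rewrite big_filter [in RHS](eq_bigr (fun w =>
    iter i.+1 (@heavy_mean R V G theta) (fun=> 1) w)); last first.
  by move=> w _; rewrite hE// lt0n i0 leqnn.
set t := \sum_(_ <- _ | _) _.
(* Without heavy neighbors the program divides by 0, which gives 0, and the sum on the other side is
   empty; otherwise the number of heavy neighbors cancels. *)
case: (posnP (size [seq w <- nbrs G v | heavy G theta w])) => [sz0|szp].
  rewrite sz0 !mul0r /t -big_filter (size0nil sz0) big_nil mulr0//.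
have sz : (size [seq w <- nbrs G v | heavy G theta w])%:R != 0 :> R.
  by rewrite pnatr_eq0 -lt0n.
have dv : (degree G v)%:R != 0 :> R.
  by rewrite pnatr_eq0 -lt0n (leq_ltn_trans _ hv).
by field; rewrite sz dv.
Qed.

Definition fallback_table (theta l m : nat) (eps : R) : seq (V * V * R) :=
  let c e := 1 - iter l (@heavy_mean R V G theta) (fun=> 1) e.1 in
  let S := \sum_(e <- edge_list) c e in
  [seq (e, (m%:R^-1 - (1 - eps) * (c e / S)) / eps) | e <- edge_list].

(** The hypothesis makes the index l - 1 at least 1, where the values of [h] filled in by the phases
    begin. *)
Lemma reduces_fallback m eps : (1 < levels eps)%N ->
  reduces G (exact_fallback V m eps)
    (ask (Draw (fallback_table (threshold R m) (levels eps) m eps)))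
    (2 + (levels eps + 1) * (#|V| + #|edges G|) + 4 * #|edges G|)%N.
Proof.
move=> l1; set theta := threshold R m; set l := levels eps.
(* The summands follow the program: [theta], [l], neighbor lists, heavy lists, phases, edge list,
   [S], table. *)
have -> : (2 + (l + 1) * (#|V| + #|edges G|) + 4 * #|edges G| =
   1 + (1 + ((#|V| + #|edges G|) + (#|edges G| + (l * (#|V| + #|edges G|) +
   (#|edges G| + (#|edges G| + (#|edges G| + 0))))))))%N by ring.
apply: det_bind; first exact: det_compute.
apply: det_bind; first exact: det_compute.
apply: det_bind; first exact: det_neighbor_lists.
apply: det_bind; first exact: det_heavy_lists.
have [h hdet hE] := det_h_phases theta l.
apply: det_bind; first exact: hdet.
apply: (@det_bind _ _ _ _ _ _ _ [seq [seq (v, w) | w <- nbrs G v] | v <- enum V]).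
  rewrite card_edges -big_enum; apply: det_mapM => v _.
  rewrite -size_nbrs -sum1_size; apply: det_mapM => w _; exact: det_compute.
rewrite -/edge_list.
rewrite -{1}size_edge_list; apply: det_bind; first exact: det_sumM.
rewrite -size_edge_list -sum1_size; apply: det_bind.
  apply: det_mapM => e _; exact: det_compute.
set T := [seq _ | _ <- _].
rewrite (_ : T = fallback_table theta l m eps); first exact: reduces_refl.
(* Since h_{v,j} is the iterate of order j + 1, the index l - 1 yields B^l 1, the function in the
   law of a round. *)
have hlE v : h l.-1 v = iter l (@heavy_mean R V G theta) (fun=> 1) v.
  by rewrite hE ?prednK//; lia.
rewrite /T /fallback_table; under eq_bigr do rewrite hlE.
by apply: eq_map => e; rewrite hlE.
Qed.

End Fallback.

(** * The whole algorithm *)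

Section Rounding.
Context (R : realType).

Lemma absz_ceil_itv (x : R) : 0 <= x ->
  x <= `|Num.ceil x|%N%:R :> R /\ `|Num.ceil x|%N%:R <= x + 1 :> R.
Proof.
move=> x0; have c0 : 0 <= Num.ceil x by rewrite ceil_ge0 (lt_le_trans _ x0)// ltrN10.
rewrite natr_absz ger0_norm//; have /andP[h1 h2] := ceil_itv x.
by split=> //; move: h1; rewrite intrB ltrBlDr => /ltW.
Qed.

(** Here l - 1 is the ceiling of 3 log2 n, which gives the bound by eps; as log2 n >= 1, also l <= 3
    log2 n + 2 <= 5 log2 n. *)
Lemma levels_bounds n (eps := (n ^ 3)%:R^-1 : R) : (1 < n)%N ->
  [/\ (1 < levels eps)%N, 2 ^- (levels eps).-1 <= eps &
      (levels eps)%:R <= 5 * (ln n%:R / ln 2) :> R].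
Proof.
move=> n1; have n0 : 0 < n%:R :> R by rewrite ltr0n ltnW.
have ln2 : 0 < ln 2 :> R by rewrite ln_gt0// ltr1n.
have lnn : ln 2 <= ln n%:R :> R by rewrite ler_ln ?posrE// ?ltr0n// ler_nat.
have lneps : ln eps^-1 = 3 * ln n%:R.
  by rewrite invrK natrX lnXn// mulr_natl.
have q1 : 1 <= ln n%:R / ln 2 :> R by rewrite ler_pdivlMr// mul1r.
have [h1 h2] : ln eps^-1 / ln 2 <= (levels eps).-1%:R /\
    (levels eps).-1%:R <= ln eps^-1 / ln 2 + 1 :> R.
  have x0 : 0 <= ln eps^-1 / ln 2.
    by rewrite lneps -mulrA mulr_ge0// (le_trans ler01 q1).
  exact: absz_ceil_itv x0.
rewrite lneps -mulrA in h1 h2.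
have lE : levels eps = (levels eps).-1.+1 by [].
split.
- rewrite lE ltnS -(ltr0n R); apply: lt_le_trans h1; lra.
- have e0 : 0 < eps by rewrite invr_gt0 ltr0n expn_gt0 ltnW.
  rewrite invf_ple ?posrE ?exprn_gt0//.
  rewrite -(@ler_ln R eps^-1) ?posrE ?exprn_gt0//; last by rewrite invr_gt0.
  rewrite lneps lnXn//.
  by rewrite -[ln 2 *+ _]mulr_natl -ler_pdivrMr// -mulrA.
by rewrite lE -natr1; lra.
Qed.

(** The factor 3 comes from sqrt (2 m) + 1 <= 2 sqrt m + sqrt m for m >= 1. *)
Lemma threshold_bounds m : (0 < m)%N ->
  [/\ (0 < threshold R m)%N, (2 * m <= threshold R m ^ 2)%N &
      (threshold R m)%:R <= 3 * Num.sqrt m%:R :> R].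
Proof.
move=> m0; have [h1 h2] := absz_ceil_itv (sqrtr_ge0 (2 * m%:R : R)).
rewrite -/(threshold R m) in h1 h2.
have s1 : 1 <= Num.sqrt m%:R :> R by rewrite -[leLHS]sqrtr1 ler_wsqrtr// ler1n.
have s2 : Num.sqrt (2 * m%:R) <= 2 * Num.sqrt m%:R :> R.
  rewrite -[X in X * Num.sqrt _]ger0_norm// -sqrtr_sqr -sqrtrM ?sqr_ge0//.
  by rewrite ler_wsqrtr// ler_wpM2r// -natrX ler_nat.
have large : (2 * m <= threshold R m ^ 2)%N.
  rewrite -(ler_nat R) natrM natrX -[leLHS]sqr_sqrtr ?mulr_ge0//.
  by rewrite lerXn2r ?nnegrE ?sqrtr_ge0.
by split=> //; [case: (threshold R m) large; lia|lra].
Qed.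

End Rounding.

(** * Output law and cost of the two branches *)

Section Sampling.
Context (R : realType) (V : finType) (G : graph V) (theta l : nat) (eps : R).
Local Notation m := #|edges G|.
Local Notation B := (@heavy_mean R V G theta).
Hypothesis edges_gt0 : (0 < m)%N.
Hypothesis theta_gt0 : (0 < theta)%N.
Hypothesis theta_large : (2 * m <= theta ^ 2)%N.
Hypothesis l_gt0 : (0 < l)%N.
Hypothesis eps_large : 2 ^- l.-1 <= eps.
Hypothesis eps_itv : 0 < eps < 1.

Lemma card_gt1 : (1 < #|V|)%N.
Proof.
have [[v w]] := card_gt0P edges_gt0; rewrite inE /= => vw.
rewrite (cardD1 v) (cardD1 w) !inE /= andbT.
by case: eqVneq => // wv; move: vw; rewrite wv adj_irr.
Qed.

Definition weight v : R := 1 - iter l B (fun=> 1) v.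

Definition weight_sum : R := \sum_(e <- edge_list G) weight e.1.

Lemma weight_bounds v : 1 - eps <= weight v <= 1.
Proof.
have := iter_heavy_mean_bounds R theta_large l.-1 v.
rewrite prednK// /weight => /andP[h0 h1].
rewrite gerBl h0 andbT lerD2l lerN2; apply: le_trans eps_large.
apply: le_trans h1 _; rewrite ler_piMl ?invr_ge0 ?exprn_ge0//.
by case: heavy.
Qed.

Lemma weight_sum_bounds : (1 - eps) * m%:R <= weight_sum <= m%:R.
Proof.
have sumc c : c * m%:R = \sum_(e <- edge_list G) c.
  by rewrite -size_edge_list big_const_seq count_predT iter_addr_0 mulr_natr.
rewrite -[X in _ && (_ <= X)]mul1r !sumc; apply/andP; split.
  by apply: ler_sum => e _; case/andP: (weight_bounds e.1).
by apply: ler_sum => e _; case/andP: (weight_bounds e.1).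
Qed.

Lemma weight_sum_gt0 : 0 < weight_sum.
Proof.
case/andP: weight_sum_bounds => + _; apply: lt_le_trans.
by rewrite mulr_gt0 ?ltr0n// subr_gt0; case/andP: eps_itv.
Qed.

Lemma prob_round phi : unit_valued phi ->
  prob G (one_round R V theta l) (lift_some phi) =
  (l%:R * (#|V|%:R * theta%:R))^-1 *
  \sum_(e <- edge_list G) weight e.1 * phi e.
Proof.
move=> u; rewrite prob_one_round// big_edge_list; congr (_ * _).
by apply: eq_bigr => v _; rewrite mulr_sumr.
Qed.

Let unit1 A : unit_valued (fun _ : A => 1 : R).
Proof. by move=> a; rewrite ler01 lexx. Qed.

Let round1 : prob G (one_round R V theta l) (fun=> 1) = 1.
Proof. by apply: prob_one_round1 => //; exact: ltnW card_gt1. Qed.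

Let round_success : prob G (one_round R V theta l) (lift_some (fun=> 1)) =
  (l%:R * (#|V|%:R * theta%:R))^-1 * weight_sum.
Proof. by rewrite prob_round//; under eq_bigr do rewrite mulr1. Qed.

Let rounds_gt0 : 0 < l%:R * (#|V|%:R * theta%:R) :> R.
Proof. by rewrite !mulr_gt0 ?ltr0n// ltnW// card_gt1. Qed.

(** Retrying conditions on success: the common factor 1 / (l n theta) cancels and the weights are
    normalized by their sum. *)
Lemma prob_retry_round phi : unit_valued phi ->
  prob G (retry (one_round R V theta l)) phi =
  \sum_(e <- edge_list G) weight e.1 / weight_sum * phi e.
Proof.
move=> u; have := prob_retry round1 u; rewrite round_success prob_round//.
rewrite mulrCA => /(mulfI (invr_neq0 (lt0r_neq0 rounds_gt0))) h.
apply: (mulIf (lt0r_neq0 weight_sum_gt0)); rewrite h mulr_suml.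
by apply: eq_bigr => e _; rewrite mulrAC divfK// lt0r_neq0// weight_sum_gt0.
Qed.

(** A round succeeds with probability at least (1 - eps) m / (l n theta) and costs 12, plus 1 for a
    restart. The factor 1 - eps stays on the left, where it becomes the probability of this
    branch. *)
Lemma wp_retry_round N :
  (1 - eps) * wp G 1 N (retry (one_round R V theta l)) (fun=> 0) <=
  13 * (l%:R * (#|V|%:R * theta%:R) / m%:R).
Proof.
have := wp_retry_le round1 N (fun N => wp_one_round R theta_large N l).
rewrite round_success; set Y := wp _ _ _ _ _ => h.
rewrite mulrA ler_pdivlMr ?ltr0n// -ler_pdivrMr//.
have -> : 13 = 12 + 1 :> R by ring.
apply: le_trans h; set K := (_ * _)^-1.
have -> : (1 - eps) * Y * m%:R * K = Y * (K * ((1 - eps) * m%:R)) by ring.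
rewrite ler_wpM2l ?wp_ge0// ler_wpM2l ?invr_ge0 ?(ltW rounds_gt0)//.
by case/andP: weight_sum_bounds.
Qed.

(** Nonnegativity means (1 - eps) c_e / S <= 1 / m, which follows from c_e <= 1 and S >= (1 - eps)
    m. The entries sum to (1 - (1 - eps)) / eps = 1. *)
Lemma is_distr_table : is_distr (fallback_table G theta l m eps).
Proof.
have [e0 e1] := andP eps_itv; have S0 := weight_sum_gt0.
have /andP[Sl Su] := weight_sum_bounds.
have m0 : 0 < m%:R :> R by rewrite ltr0n.
rewrite /is_distr all_map big_map /=; apply/andP; split.
  apply/allP => e _ /=; rewrite -/(weight e.1) -/weight_sum.
  rewrite divr_ge0 ?(ltW e0)// subr_ge0 mulrA ler_pdivrMr// ler_pdivlMl//.
  apply: le_trans Sl; rewrite mulrC ler_wpM2r ?(ltW m0)// ler_piMr//.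
    by rewrite subr_ge0 ltW.
  by case/andP: (weight_bounds e.1).
rewrite -mulr_suml sumrB -mulr_sumr -mulr_suml -/weight_sum divff ?lt0r_neq0//.
rewrite big_const_seq count_predT size_edge_list iter_addr_0 -[_ *+ _]mulr_natr.
by rewrite mulVf ?lt0r_neq0// mulr1 opprB addrC subrK divff// lt0r_neq0.
Qed.

Lemma prob_table phi : unit_valued phi ->
  prob G (ask (Draw (fallback_table G theta l m eps))) phi =
  \sum_(e <- edge_list G)
    (m%:R^-1 - (1 - eps) * (weight e.1 / weight_sum)) / eps * phi e.
Proof.
move=> u; rewrite /ask prob_op//= is_distr_table big_map.
by apply: eq_bigr => e _ /=; rewrite prob_ret.
Qed.

End Sampling.

(** Strictness leaves room for one more instruction, the final draw. *)
Lemma fallback_cost_le l n m : (0 < l)%N -> (1 < n)%N -> (m <= n ^ 2)%N ->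
  (2 + (l + 1) * (n + m) + 4 * m < 11 * l * n ^ 2)%N.
Proof.
move=> l0 n1 mn; have nn : (2 * n <= n ^ 2)%N by rewrite -mulnn leq_mul2r n1 orbT.
have : ((l + 1) * (n + m) <= (l + l) * (n ^ 2 + n ^ 2))%N by apply: leq_mul; lia.
have : (n ^ 2 <= l * n ^ 2)%N by rewrite leq_pmull.
lia.
Qed.

(** * Combination of the branches *)

Section SampleExactly.
Context (R : realType) (V : finType) (G : graph V).
Hypothesis edges_gt0 : (0 < #|edges G|)%N.
Local Notation m := #|edges G|.
Local Notation n := #|V|.
Local Notation eps := ((n ^ 3)%:R^-1 : R).
Local Notation theta := (threshold R m).
Local Notation l := (levels eps).

Let n_gt1 : (1 < n)%N := card_gt1 edges_gt0.

Let eps_itv : 0 < eps < 1.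
Proof.
rewrite invr_gt0 ltr0n expn_gt0 (ltnW n_gt1) invf_lt1 ?ltr0n ?expn_gt0 ?(ltnW n_gt1)//.
by rewrite ltr1n -[1%N](exp1n 3) ltn_exp2r.
Qed.

Let coin : seq (bool * R) := [:: (true, 1 - eps); (false, eps)].

Let is_distr_coin : is_distr coin.
Proof.
have [e0 e1] := andP eps_itv.
by rewrite /is_distr /= subr_ge0 !ltW// !big_cons big_nil addr0 subrK eqxx.
Qed.

Let reduces_sample_edge :
  reduces G (sample_edge V m eps) (retry (one_round R V theta l)) 2.
Proof.
apply: (@det_bind _ _ _ _ _ _ _ _ _ 1 1); first exact: det_compute.
rewrite -[1%N]addn0; apply: det_bind; first exact: det_compute.
exact: reduces_refl.
Qed.

Let start := bind (ask (@Draw R V bool coin)) (fun b : bool =>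
  if b then sample_edge V m eps else exact_fallback V m eps).

Let reduces_start : reduces G (sample_exactly R V m) start 1.
Proof.
rewrite -[1%N]addn0; apply: det_bind; first exact: det_compute.
exact: reduces_refl.
Qed.

(** Whatever probability x the first branch gives to an edge, the table corrects it: (1 - eps) x +
    eps ((1 / m - (1 - eps) x) / eps) = 1 / m. *)
Lemma prob_sample_exactly phi : unit_valued phi ->
  prob G (sample_exactly R V m) phi = \sum_(e in edges G) m%:R^-1 * phi e.
Proof.
move=> u; have [e0 e1] := andP eps_itv.
have [l1 epsl _] := levels_bounds R n_gt1.
have [theta0 thetal _] := threshold_bounds R edges_gt0.
rewrite (prob_reduces u reduces_start) prob_ask//= is_distr_coin !big_cons big_nil.
rewrite addr0 /= (prob_reduces u reduces_sample_edge).
rewrite (prob_reduces u (reduces_fallback G _ l1)).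
rewrite (prob_retry_round edges_gt0 theta0 thetal (ltnW l1) epsl eps_itv u).
rewrite (prob_table edges_gt0 thetal (ltnW l1) epsl eps_itv u).
rewrite !mulr_sumr -big_split big_edges big_edge_list; apply: eq_bigr => v _.
apply: eq_bigr => w _ /=; set x := weight _ _ _ _ _ / _.
have m0 : m%:R != 0 :> R by rewrite pnatr_eq0 -lt0n.
by move: (lt0r_neq0 e0); move: (eps) x => d x d0; field; rewrite ?d0 ?m0.
Qed.

(** The cost is at most 54 Q with Q = l n / sqrt m, and l <= 5 ln n / ln 2 gives 270 = 54 * 5. *)
Lemma wp_sample_exactly N :
  wp G 1 N (sample_exactly R V m) (fun=> 0) <=
  270 / ln 2 * (n%:R * ln n%:R / Num.sqrt m%:R).
Proof.
(* Here [d] is eps, [q] is Q, and [y] and [z] are the costs of the retries and of the fallback,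
   weighted by their branch probabilities. The other steps number at most 4 on average, whence 54 =
   39 + 11 + 4. *)
have budget (d x y z q : R) : 0 < d -> 1 <= q -> y <= x -> x <= 39 * q ->
    z <= 11 * q -> 1 + (1 + (2 * (1 - d) + y + z)) <= 54 * q.
  by move=> *; lra.
have [e0 e1] := andP eps_itv.
have [l1 epsl lle] := levels_bounds R n_gt1.
have [theta0 thetal thetale] := threshold_bounds R edges_gt0.
have wp_edge := wp_reduces N (fun=> lexx 0) reduces_sample_edge.
have wp_fall := wp_reduces N (fun=> lexx 0) (reduces_fallback G m l1).
have := wp_retry_round edges_gt0 theta0 thetal (ltnW l1) epsl N.
have wp_table : wp G 1 N (ask (Draw (fallback_table G theta l m eps))) (fun=> 0) <= 1.
  case: N {wp_edge wp_fall} => [|N] //=; rewrite big1 ?addr0// => e _.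
  by rewrite wp_ret mulr0.
have {wp_fall wp_table} := le_trans wp_fall (lerD (lexx _) wp_table).
set s := Num.sqrt _.
set F := wp _ _ _ (exact_fallback _ _ _) _ => wp_fall.
set Y := wp _ _ _ (retry _) _ => wp_retry.
apply: le_trans (wp_reduces N (fun=> lexx 0) reduces_start) _.
have wp_start : wp G 1 N start (fun=> 0) <= 1 + ((1 - eps) * (2 + Y) + eps * F).
  apply: le_trans (wp_ask_le _ _ _ _ _ _) _ => //=.
  rewrite is_distr_coin !big_cons big_nil addr0 /= lerD2l lerD2r.
  by rewrite ler_wpM2l ?subr_ge0 ?(ltW e1).
apply: le_trans (lerD (lexx _) wp_start) _.
have m1 : 1 <= m%:R :> R by rewrite ler1n.
have s1 : 1 <= s by rewrite -[leLHS]sqrtr1 ler_wsqrtr.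
have ss : s * s = m%:R by rewrite -expr2 sqr_sqrtr.
have mn : (m <= n ^ 2)%N.
  by rewrite (leq_trans (max_card _))// card_prod mulnn.
have s0 : 0 < s by exact: lt_le_trans s1.
have sn : s <= n%:R.
  rewrite -[leRHS]ger0_norm// -sqrtr_sqr ler_wsqrtr// -natrX ler_nat//.
set Q := l%:R * n%:R / s.
(* By sqrt m <= n, a cost of order l, such as the weighted cost of the fallback, is absorbed in
   Q. *)
have lQ : l%:R <= Q by rewrite /Q ler_pdivlMr// ler_wpM2l.
have Q1 : 1 <= Q by apply: le_trans lQ; rewrite ler1n ltnW.
(* The factor 3 is that of theta <= 3 sqrt m. *)
have wp_retryQ : 13 * (l%:R * (n%:R * theta%:R) / m%:R) <= 39 * Q.
  have -> : 39 = 13 * 3 :> R by ring.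
  rewrite -[leRHS]mulrA ler_wpM2l// /Q ler_pdivrMr ?(lt_le_trans ltr01 m1)//.
  have -> : l%:R * (n%:R * theta%:R) = l%:R * n%:R * theta%:R :> R by ring.
  have -> : 3 * (l%:R * n%:R / s) * m%:R = l%:R * n%:R * (3 * s).
    by rewrite -ss; field; exact: lt0r_neq0.
  by rewrite ler_wpM2l// mulr_ge0.
have wp_fallQ : eps * F <= 11 * Q.
  apply: (@le_trans _ _ (eps * (11 * l * n ^ 2)%:R)).
    rewrite ler_wpM2l ?(ltW e0)//; apply: le_trans wp_fall _.
    rewrite natr1 ler_nat; by rewrite fallback_cost_le// ltnW.
  apply: (@le_trans _ _ (11 * l%:R)); last by rewrite ler_wpM2l.
  rewrite ler_pdivrMl ?ltr0n ?expn_gt0 ?(ltnW n_gt1)// -!natrM ler_nat.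
  rewrite mulnC leq_mul2r; apply/orP; right.
  by rewrite leq_exp2l.
apply: (@le_trans _ _ (54 * Q)).
  have -> : (1 - eps) * (2 + Y) = 2 * (1 - eps) + (1 - eps) * Y by ring.
  exact: budget e0 Q1 wp_retry wp_retryQ wp_fallQ.
have ln2 : 0 < ln 2 :> R by rewrite ln_gt0// ltr1n.
have -> : 270 / ln 2 * (n%:R * ln n%:R / s) =
    54 * (5 * (ln n%:R / ln 2) * n%:R / s).
  by field; rewrite !lt0r_neq0.
by rewrite ler_wpM2l// /Q ler_wpM2r ?invr_ge0 ?(ltW s0)// ler_wpM2r.
Qed.

End SampleExactly.

Theorem theorem7 (R : realType) :
  exists2 C : R, 0 < C &
  forall (V : finType) (G : graph V), (0 < #|edges G|)%N ->
  let m := #|edges G| in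
  let n := #|V| in
  [/\ terminates_as G (sample_exactly R V m),
      forall e : V * V,
        output_prob G (sample_exactly R V m) e =
        (if e \in edges G then m%:R^-1 else 0)%:E
    & (expected_time G (sample_exactly R V m) <=
       (C * (n%:R * ln n%:R / Num.sqrt m%:R))%:E)%E].
Proof.
exists (270 / ln 2); first by rewrite divr_gt0// ln_gt0// ltr1n.
move=> V G edges_gt0 m n; split.
(* Termination is the case phi = 1 of [prob_sample_exactly]; the output law is the case of an
   indicator. *)
- apply: terminates_asE; rewrite prob_sample_exactly//; last first.
    by move=> e; rewrite ler01 lexx.
  rewrite -mulr_sumr sumr_const mulVf// pnatr_eq0 -lt0n//.
- move=> e; rewrite output_probE prob_sample_exactly//; last first.
    by move=> e'; rewrite ler0n lern1; case: eqP.
  congr (_%:E); rewrite big_mkcond (bigD1 e)//= eqxx mulr1 big1 ?addr0// => e' ne.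
  by rewrite (negbTE ne) mulr0 if_same.
by apply: expected_time_le => N; exact: wp_sample_exactly.
Qed.
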